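(* For every integer $\ell\ge 1$ there exist an abelian group $G$ of order $3\ell^2+1$ and a $(3\ell^2+1,3,\ell,2)$-EDF over $G$.
   Context: For subsets $A,B$ of an additive group $G$, $\Delta(A,B)$ denotes the multiset $\{a-b\mid a\in A,\ b\in B\}$. A $(v,m,\ell,\lambda)$-EDF (external difference family) over a group $G$ of order $v$ is a family $\{A_0,\dots,A_{m-1}\}$ of $m\ge 2$ pairwise disjoint $\ell$-subsets of $G$ such that the multiset union $\bigcup_{i\ne j}\Delta(A_i,A_j)$, over all ordered pairs $(i,j)$ with $i\neq j$, equals $\lambda(G\setminus\{0\})$, i.e. contains each nonzero element of $G$ exactly $\lambda$ times and does not contain $0$. *)

(* Defs.v *)
From HB Require Import structures.
From mathcomp Require Import all_boot all_algebra.
From mathcomp Require Import finmap multiset.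

Set Implicit Arguments.
Unset Strict Implicit.
Unset Printing Implicit Defensive.

Import GRing.Theory.

Local Open Scope ring_scope.
Local Open Scope mset_scope.

Definition Delta (G : finZmodType) (A B : {set G}) : {mset G} :=
  seq_mset [seq a - b | a <- enum A, b <- enum B].

(* The union of multisets adds multiplicities, so it is an iterated [msetD];
   [msetn n x] is the multiset made of [n] copies of [x]. *)
Definition external_differences (G : finZmodType) (m : nat)
    (A : 'I_m -> {set G}) : {mset G} :=
  \big[msetD/mset0]_(p : 'I_m * 'I_m | p.1 != p.2) Delta (A p.1) (A p.2).

Definition nonzero_mset (G : finZmodType) (lambda : nat) : {mset G} :=
  \big[msetD/mset0]_(x in [set~ (0 : G)]) msetn lambda x.

Definition is_EDF (G : finZmodType) (v m l lambda : nat)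
    (A : 'I_m -> {set G}) : Prop :=
  [/\ #|G| = v,
      (2 <= m)%N,
      forall i, #|A i| = l,
      forall i j, i != j -> [disjoint A i & A j]
    & external_differences A = nonzero_mset G lambda].

(* Main.v *)
From HB Require Import structures.
Require Import Defs.
From mathcomp Require Import all_boot all_algebra.
From mathcomp Require Import finmap multiset zify.

Set Implicit Arguments.
Unset Strict Implicit.
Unset Printing Implicit Defensive.

Import GRing.Theory.
Local Open Scope mset_scope.
Local Open Scope ring_scope.

(** Let w be a primitive cube root of unity. The group is the residue ring
    Z[w]/(1 + l sqrt(-3)), where sqrt(-3) = w - w^2; its order is the norm
    1 + 3 l^2, and multiplication by w is an automorphism of order 3. Write
    u i for the image of w^i.

    The three rhombi {a w^i + b w^(i+1) : 1 <= a <= l, 0 <= b < l} have angle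
    120 degrees at the origin, and together with the origin they tile a hexagon
    of side l in the triangular lattice. This hexagon has 3 l^2 + 1 points and
    is a complete system of residues. To see this, one checks that its image is
    stable under adding any u i ([hexagon_step]): a step that leaves the hexagon
    re-enters it at the opposite side because of the relation
    1 + l (w - w^2) = 0 ([cell_top], [cell_right]). So the hexagon covers the
    group, and by counting it covers every element exactly once
    ([rhombi_count]).

    It remains to realize the rhombi as sets of differences. Let block i be the
    progression {c i + j u i : 0 <= j < l}. A difference of block i and
    block (i + 1) is c i - c (i + 1) + j u i - k u (i + 1), and it runs over the
    rhombus number i as soon as c i - c (i + 1) = u i + (l - 1) u (i + 1). Such
    offsets c exist because sqrt(-3), hence 1 - w, is invertible modulo
    1 + l sqrt(-3), with inverse - l w ([base_diff]). Thus the differences from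
    each block to the next one contain each nonzero element exactly once; the
    opposite differences do so too, which gives multiplicity 2.

    The group is used only through the family u and its relations, collected in
    [hexagonal_frame]. Depending on the parity of l, it is cyclic or the product
    of Z/2 and a cyclic group ([hexagonal_group]). *)

(** * Indices modulo 3 *)

Lemma Z3_succ3 (i : 'I_3) : i + 1 + 1 + 1 = i.
Proof. by case: i => [[|[|[|]]]] // ?; apply/val_inj. Qed.

Lemma Z3_cases (i k : 'I_3) : [\/ k = i, k = i + 1 | k = i + 1 + 1].
Proof.
by move: i k => [[|[|[|]]]] // ? [[|[|[|]]]] // ?;
  first [ by constructor 1; apply/val_inj
        | by constructor 2; apply/val_inj
        | by constructor 3; apply/val_inj ].
Qed.

Lemma sum_off_diagonal (F : 'I_3 -> 'I_3 -> nat) :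
  (\sum_(p : 'I_3 * 'I_3 | p.1 != p.2) F p.1 p.2 =
   \sum_i F i (i + 1)%R + \sum_i F (i + 1)%R i)%N.
Proof.
rewrite -(pair_big_dep xpredT (fun i j => i != j) F) /=.
rewrite [X in (_ + X)%N](reindex_inj (addIr (1 + 1))) /= -big_split /=.
apply: eq_bigr => i _; rewrite addrA Z3_succ3.
have [i1 i2 i12] : [/\ i != i + 1, i != i + 1 + 1 & i + 1 + 1 != i + 1].
  by case: i => [[|[|[|]]]].
rewrite (bigD1 (i + 1)) //= (bigD1 (i + 1 + 1)) ?i2 //= big1 ?addn0 // => j.
by case: (Z3_cases i j) => ->; rewrite ?eqxx ?andbF.
Qed.

(** * The hexagon of side l *)

(** The family u behaves like the classes of 1, w, w^2 in the quotient of Z[w]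
    by 1 + l (w - w^2); the second clause is this relation multiplied by w^i. *)
Definition hexagonal_frame (G : finZmodType) (l : nat) (u : 'I_3 -> G) : Prop :=
  [/\ forall i, u i + u (i + 1) + u (i + 1 + 1) = 0,
      forall i, u i = u (i + 1 + 1) *+ l - u (i + 1) *+ l
    & forall x, exists a b, x = u 0 *+ a + u 1 *+ b].

Section Hexagon.

Variables (G : finZmodType) (l : nat) (u : 'I_3 -> G).
Hypothesis l_gt0 : (0 < l)%N.
Hypothesis u_frame : hexagonal_frame l u.

Let u_sum0 i : u i + u (i + 1) + u (i + 1 + 1) = 0.
Proof. by case: u_frame. Qed.

Let u_relation i : u i = u (i + 1 + 1) *+ l - u (i + 1) *+ l.
Proof. by case: u_frame. Qed.

Definition cell (i : 'I_3) (a b : nat) : G := u i *+ a + u (i + 1) *+ b.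

(** The row b = l lies just beyond the rhombus i, across a side of the hexagon.
    The relation translates it onto the far side of the rhombus i + 2. *)
Lemma cell_top (i : 'I_3) (a : nat) :
  cell i a.+1 l = cell (i + 1 + 1) l a.
Proof.
by rewrite /cell Z3_succ3 mulrSr -addrA {2}(u_relation i) subrK addrC.
Qed.

(** The row a = l + 1 lies just beyond the rhombus i, across its other outer side.
    The relation translates it onto the far side of the rhombus i + 1. *)
Lemma cell_right (i : 'I_3) (b : nat) :
  cell i l.+1 b = cell (i + 1) b l.-1.
Proof.
have := u_relation (i + 1); rewrite Z3_succ3 => /eqP.
rewrite eq_sym subr_eq => /eqP ul.
rewrite /cell addrC; congr (_ + _).
by rewrite mulrS ul -[in LHS](prednK l_gt0) mulrS !addrA u_sum0 add0r.
Qed.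

(** The value a = 0 is admitted here, unlike in the rhombi: it puts the origin on
    the same footing as the other points, and it repeats an edge of the next
    rhombus. *)
Definition in_hexagon (x : G) :=
  exists i a b, [/\ (a <= l)%N, (b < l)%N & x = cell i a b].

Lemma cell_in_hexagon i a b :
  (a <= l)%N -> (b <= l)%N -> in_hexagon (cell i a b).
Proof.
move=> al; rewrite leq_eqVlt => /predU1P[->|bl]; last by exists i, a, b.
case: a al => [_|a al]; last by rewrite cell_top; exists (i + 1 + 1), l, a.
by exists (i + 1), l, 0%N; split=> //; rewrite /cell !mulr0n addr0 add0r.
Qed.

(** From the rhombus i, a step u i or u (i + 1) increases one coordinate, and the
    gluing applies when it crosses a side. The step u (i + 1 + 1) is
    - u i - u (i + 1), which decreases both coordinates; when one of them is 0,
    the new point is a u (i + 1 + 1) + b u i or a u (i + 1) + b u (i + 1 + 1) with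
    a, b <= l, a combination for an adjacent rhombus. *)
Lemma hexagon_step x k : in_hexagon x -> in_hexagon (x + u k).
Proof.
case=> i [a [b [al bl ->]]]; case: (Z3_cases i k) => ->.
- have -> : cell i a b + u i = cell i a.+1 b by rewrite /cell addrAC mulrSr.
  move: al; rewrite leq_eqVlt => /predU1P[->|al].
    by rewrite cell_right; apply: cell_in_hexagon; [exact: ltnW | exact: leq_pred].
  exact: cell_in_hexagon al (ltnW bl).
- have -> : cell i a b + u (i + 1) = cell i a b.+1 by rewrite /cell -addrA mulrSr.
  exact: cell_in_hexagon.
- case: a al => [_|a al].
    rewrite /cell mulr0n add0r -[u (i + 1 + 1)]mulr1n -/(cell (i + 1) b 1).
    exact: cell_in_hexagon (ltnW bl) l_gt0.
  case: b bl => [_|b bl].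
    rewrite /cell mulr0n addr0 addrC -[u (i + 1 + 1)]mulr1n.
    rewrite -{2}(Z3_succ3 i) -/(cell (i + 1 + 1) 1 a.+1).
    exact: cell_in_hexagon.
  have -> : cell i a.+1 b.+1 + u (i + 1 + 1) = cell i a b.
    by rewrite /cell !mulrSr addrACA -[LHS]addrA u_sum0 addr0.
  exact: cell_in_hexagon (ltnW al) (ltnW (ltnW bl)).
Qed.

Lemma hexagon_covers x : in_hexagon x.
Proof.
have addMn k n y : in_hexagon y -> in_hexagon (y + u k *+ n).
  move=> hy; elim: n => [|a IH]; first by rewrite mulr0n addr0.
  by rewrite mulrSr addrA; apply: hexagon_step.
have [_ _ /(_ x)[a [b ->]]] := u_frame.
rewrite -[_ *+ a]add0r; apply: (addMn); apply: (addMn).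
by exists 0, 0%N, 0%N; rewrite /cell !mulr0n addr0.
Qed.

Definition rhombus (i : 'I_3) (p : 'I_l * 'I_l) : G := cell i p.1.+1 p.2.

Definition tile (t : option ('I_3 * ('I_l * 'I_l))) : G :=
  if t is Some (i, p) then rhombus i p else 0.

Lemma tile_surj x : exists t, x = tile t.
Proof.
have [i [[|a] [b [al bl ->]]]] := hexagon_covers x.
  case: b bl => [_|b bl]; first by exists None; rewrite /cell !mulr0n addr0.
  exists (Some (i + 1, (Ordinal (ltnW bl), Ordinal l_gt0))).
  by rewrite /= /rhombus /cell mulr0n add0r addr0.
by exists (Some (i, (Ordinal al, Ordinal bl))).
Qed.

Hypothesis card_G : #|G| = (3 * l ^ 2 + 1)%N.

(** [tile] is a surjection between sets of the same cardinal 3 l^2 + 1. *)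
Lemma tile_bij : bijective tile.
Proof.
have /fin_all_exists[t tK] := tile_surj.
have t_inj : injective t by move=> x y e; rewrite (tK x) e -tK.
have card_le : (#|{: option ('I_3 * ('I_l * 'I_l))}| <= #|G|)%N.
  by rewrite card_option !card_prod !card_ord card_G addn1 mulnn.
have [s sK Ks] := inj_card_bij t_inj card_le.
by exists t => // y; rewrite -(Ks y) -tK.
Qed.

Lemma rhombi_count (x : G) :
  (\sum_i \sum_p (rhombus i p == x) = (x != 0%R))%N.
Proof.
have [t tK Kt] := tile_bij.
rewrite pair_bigA /=.
have [->|x0] := eqVneq x 0.
  apply: big1 => -[i p] _ /=; apply/eqP; rewrite eqb0; apply/eqP => e.
  by have := bij_inj tile_bij (e : tile (Some (i, p)) = tile None).
case E : (t x) => [q|]; last by move: x0; rewrite -(Kt x) E eqxx.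
rewrite (bigD1 q) //= big1 ?addn0 => [|[i p] /negPf ne].
  by rewrite -(Kt x) E; case: (q) => i p; rewrite eqxx.
apply/eqP; rewrite eqb0; apply/eqP => e; move/eqP: ne; apply.
by apply: Some_inj; rewrite -E -e; apply/esym/(tK (Some (i, p))).
Qed.

(** * Progressions whose differences are the rhombi *)

(** This is - l w (w^i + (l - 1) w^(i + 1)), the quotient by 1 - w of the corner
    of the rhombus i that [base_diff] asks for. *)
Definition base (i : 'I_3) : G := - (u (i + 1) + u (i + 1 + 1) *+ l.-1) *+ l.

Lemma base_diff i : base i - base (i + 1) = u i + u (i + 1) *+ l.-1.
Proof.
have r1 := u_relation (i + 1); rewrite Z3_succ3 in r1.
rewrite /base Z3_succ3 !mulNrn opprK !mulrnDl addrC opprD addrACA.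
by rewrite -u_relation !(mulrnAC _ l.-1) -mulrnBl -r1.
Qed.

Definition block (i : 'I_3) : {set G} :=
  [set base i + u i *+ (j : 'I_l) | j : 'I_l].

Lemma block_inj i : injective (fun j : 'I_l => base i + u i *+ j).
Proof.
move=> j k /addrI e; pose o := Ordinal l_gt0.
have /(bij_inj tile_bij)[] // :
  tile (Some (i, (j, o))) = tile (Some (i, (k, o))).
by rewrite /= /rhombus /cell /= !mulrS e.
Qed.

Lemma card_block i : #|block i| = l.
Proof. by rewrite card_imset ?card_ord //; apply: block_inj. Qed.

Lemma Delta_count (A B : {set G}) x :
  (Delta A B x = \sum_(a in A) \sum_(b in B) (a - b == x)%R)%N.
Proof.
rewrite /Delta mset_seqE count_flatten sumnE !big_map big_enum.
apply: eq_bigr => a _; rewrite count_map -sum1_count big_mkcond big_enum.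
by apply: eq_bigr => b _ /=; case: eqP.
Qed.

Lemma Delta_opp (A B : {set G}) x : Delta B A x = Delta A B (- x).
Proof.
rewrite !Delta_count exchange_big /=; apply: eq_bigr => a _.
by apply: eq_bigr => b _; rewrite -eqr_oppLR opprB.
Qed.

(** Reversing the second progression turns the rhombus spanned by u i and
    - u (i + 1), whose angle is 60 degrees, into a rhombus spanned by u i and
    u (i + 1). *)
Lemma Delta_block i x :
  Delta (block i) (block (i + 1)) x = (\sum_p (rhombus i p == x))%N.
Proof.
rewrite Delta_count big_imset /=; last by move=> j k _ _; apply: block_inj.
rewrite -(pair_bigA _ (fun a b => rhombus i (a, b) == x : nat)) /=.
apply: eq_bigr => j _.
rewrite big_imset /=; last by move=> ? ? _ _; apply: block_inj.
rewrite [RHS](reindex_inj rev_ord_inj) /=; apply: eq_bigr => k _.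
congr (nat_of_bool (_ == _)).
rewrite opprD addrACA base_diff /rhombus /cell /=.
have kl : (k <= l.-1)%N by rewrite -ltnS prednK.
by rewrite addrACA -mulrS -mulrnBr // -subn1 -subnDA add1n.
Qed.

Lemma Delta_block_sum (x : G) :
  (\sum_i Delta (block i) (block (i + 1)%R) x = (x != 0%R))%N.
Proof. by under eq_bigr do rewrite Delta_block; apply: rhombi_count. Qed.

(** A common element would make 0 a difference, and 0 is in no rhombus. *)
Lemma block_disjoint i j : i != j -> [disjoint block i & block j].
Proof.
have succ_disjoint k : [disjoint block k & block (k + 1)].
  apply/pred0P => y /=; apply/negP => /andP[yk yk1].
  have /eqP := Delta_block_sum 0; rewrite eqxx sum_nat_eq0 => /forallP/(_ k).
  by rewrite Delta_count /= (bigD1 y) //= (bigD1 y) //= subrr eqxx.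
case: (Z3_cases i j) => ->; first by rewrite eqxx.
  by move=> _; apply: succ_disjoint.
by move=> _; rewrite disjoint_sym -{2}(Z3_succ3 i); apply: succ_disjoint.
Qed.

Lemma external_differences_block :
  external_differences block = nonzero_mset G 2.
Proof.
apply/msetP => x.
have bigE (I : finType) (P : pred I) (F : I -> {mset G}) :
    (\big[msetD/mset0]_(i | P i) F i) x = (\sum_(i | P i) F i x)%N.
  by elim/big_rec2: _ => [|i n A _ <-]; rewrite ?mset0E ?msetE2.
rewrite /external_differences /nonzero_mset !bigE.
rewrite (sum_off_diagonal (fun i j => Delta (block i) (block j) x)).
under [X in (_ + X)%N]eq_bigr do rewrite Delta_opp.
rewrite !Delta_block_sum oppr_eq0.
under eq_bigr do rewrite msetnE.
have [->|x0] := eqVneq x 0.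
  by rewrite big1 // => y; rewrite !inE eq_sym => /negPf->.
rewrite (bigD1 x) ?inE //= eqxx big1 ?addn0 // => y /andP[_ /negPf].
by rewrite eq_sym => ->.
Qed.

Lemma block_EDF : is_EDF (3 * l ^ 2 + 1) l 2 block.
Proof.
by split; [| | apply: card_block | apply: block_disjoint
  | apply: external_differences_block].
Qed.

End Hexagon.

(** * Groups with a hexagonal frame *)

(** The frame is (e, f, - e - f). Its three relations add up to 0, so two of them
    suffice. *)
Lemma hexagonal_frame_of_generators (G : finZmodType) (l : nat) (e f : G) :
  e + (e + f *+ 2) *+ l = 0 -> f = (e *+ 2 + f) *+ l ->
  (forall x, exists a b, x = e *+ a + f *+ b) ->
  exists u : 'I_3 -> G, hexagonal_frame l u.
Proof.
move=> re rf gen; pose u (i : 'I_3) := nth 0 [:: e; f; - (e + f)] i.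
have sum0 : e + f - (e + f) = 0 by rewrite subrr.
have r0 : e = (- (e + f)) *+ l - f *+ l.
  apply/eqP; rewrite mulNrn -opprD -addr_eq0 -mulrnDl -addrA -mulr2n.
  by rewrite re.
have r1 : f = e *+ l - (- (e + f)) *+ l.
  by rewrite mulNrn opprK -mulrnDl addrA -mulr2n.
(* The sum relation at the indices 1 and 2. *)
have sum0' : f - (e + f) + e = 0 by rewrite addrC addrA.
have sum0'' : - (e + f) + e + f = 0 by rewrite -addrA addrC.
have r2 : - (e + f) = f *+ l - e *+ l.
  rewrite -opprB; congr (- _).
  by rewrite [LHS](congr2 +%R r0 r1) addrC addrA subrK.
by exists u; split=> //; case=> [[|[|[|]]]].
Qed.

HB.instance Definition _ (A B : finZmodType) := GRing.Zmodule.on (A * B)%type.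

(** For odd l = 2 k + 1 the element 1 + l sqrt(-3) is divisible by 2, so the
    group is not cyclic; the lattice is twice one of index 3 k^2 + 3 k + 1,
    modulo which w is the integer 3 k + 1. Then 1 and w correspond to (0, 1)
    and (1, 3 k + 1) in the product of Z/2 and Z/(6 k^2 + 6 k + 2). For even l
    = 2 k the group is cyclic of order 12 k^2 + 1; the relation makes sqrt(-3)
    = 3 l, so w is the half of 3 l - 1, that is 3 k (2 k + 1). *)
Lemma hexagonal_group (l : nat) : (0 < l)%N ->
  exists2 G : finZmodType, #|G| = (3 * l ^ 2 + 1)%N &
  exists u : 'I_3 -> G, hexagonal_frame l u.
Proof.
move=> l_gt0.
have natr0 (n c d : nat) : (1 < n)%N -> c = (d * n)%N -> c%:R = 0 :> 'Z_n.
  by move=> n_gt1 ->; rewrite natrM pchar_Zp // mulr0.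
have [k [kl|kl]] : exists k, l = (2 * k + 1)%N \/ l = (2 * k)%N.
  by exists l./2; have := odd_double_half l; case: (odd l); lia.
- pose n := (6 * k * k + 6 * k + 2)%N.
  have n_gt1 : (1 < n)%N by rewrite /n addn2.
  exists (('Z_2 * 'Z_n)%type : finZmodType).
    by rewrite card_prod !card_ord (Zp_cast n_gt1) (@Zp_cast 2) // kl /n; nia.
  apply: (@hexagonal_frame_of_generators _ l
    ((0 : 'Z_2), (1 : 'Z_n)) ((1 : 'Z_2), ((3 * k + 1)%:R : 'Z_n))).
  + rewrite !pairMnE /=; congr pair; rewrite /= ?add0r.
      by rewrite (natr0 2 2 1)%N // mul0rn.
    rewrite -mulrnA -(natrD _ 1) -mulrnA -(natrD _ 1).
    by apply: (natr0 _ _ 2) => //; rewrite kl /n; nia.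
  + rewrite !pairMnE /=; congr pair; rewrite /= ?mul0rn ?add0r.
      by rewrite kl mulrnDr mulrnA (natr0 2 2 1)%N // mul0rn add0r.
    apply/esym/eqP; rewrite -subr_eq0 -natrD -mulrnA -natrB; last by nia.
    by apply/eqP/(natr0 _ _ 1) => //; rewrite kl /n; nia.
  + case=> x y; have [z yE] : exists z : 'Z_n, y = z + (3 * k + 1)%:R *+ x.
      by exists (y - (3 * k + 1)%:R *+ x); rewrite subrK.
    exists z, x; rewrite !pairMnE; congr pair; rewrite /= ?natr_Zp //.
    by rewrite mul0rn add0r.
- pose n := (12 * k * k + 1)%N.
  have n_gt1 : (1 < n)%N by rewrite /n; nia.
  exists ('Z_n : finZmodType).
    by rewrite card_ord /= Zp_cast // kl /n; nia.
  apply: (@hexagonal_frame_of_generators _ l 1 ((3 * k * (2 * k + 1))%:R : 'Z_n)).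
  + rewrite -mulrnA -(natrD _ 1) -mulrnA -(natrD _ 1).
    by apply: (natr0 _ _ (2 * k + 1)%N) => //; rewrite kl /n; nia.
  + apply/esym/eqP; rewrite -subr_eq0 -natrD -mulrnA -natrB; last by nia.
    by apply/eqP/(natr0 _ _ k) => //; rewrite kl /n; nia.
  + move=> x; exists (x : nat), 0%N.
    by rewrite mulr0n addr0 natr_Zp.
Qed.

Close Scope ring_scope.
Close Scope mset_scope.

Theorem theorem4p6 (l : nat) (hl : 1 <= l) :
  exists G : finZmodType,
    #|G| = 3 * l ^ 2 + 1 /\
    exists A : 'I_3 -> {set G}, is_EDF (3 * l ^ 2 + 1) l 2 A.
Proof.
have [G cardG [u u_frame]] := hexagonal_group hl.
exists G; split=> //; exists (block l u).
exact: block_EDF.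
Qed.
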